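(* Let $d,m,n,k$ be positive integers, and let $\mathbf{R}=(R_1,\dots,R_d)$ and $\mathbf{Q}=(Q_1,\dots,Q_d)$ be two commuting $d$-tuples of bounded linear operators on $\mathcal{H}$ such that $[R_j,Q_i]=[R_j,Q_i^*]=0$ for all $i,j\in\{1,\dots,d\}$. If $\mathbf{R}$ is $(m,n)$-isosymmetric and $\mathbf{Q}$ is nilpotent of order $k$, then $\mathbf{R}+\mathbf{Q}=(R_1+Q_1,\dots,R_d+Q_d)$ is $(m+2k-2,\;n+2k-1)$-isosymmetric.
   Context: $\mathcal{H}$ is a separable complex Hilbert space and $[A,B]=AB-BA$. A $d$-tuple $\mathbf{R}=(R_1,\dots,R_d)$ of bounded linear operators on $\mathcal{H}$ is commuting if $R_iR_j=R_jR_i$ for all $i,j$. For $\gamma=(\gamma_1,\dots,\gamma_d)\in\mathbb{N}_0^d$ put $|\gamma|=\sum_j\gamma_j$, $\gamma!=\prod_j\gamma_j!$, $\mathbf{R}^\gamma=R_1^{\gamma_1}\cdots R_d^{\gamma_d}$ and $\mathbf{R}^{*\gamma}=(R_1^* )^{\gamma_1}\cdots(R_d^* )^{\gamma_d}$ (zeroth powers are $I$). For a commuting tuple $\mathbf{R}$ and integers $m,n\ge 0$ define $$\mathbf{M}_m(\mathbf{R})=\sum_{j=0}^m(-1)^{m-j}\binom{m}{j}\sum_{|\gamma|=j}\frac{j!}{\gamma!}\mathbf{R}^{*\gamma}\mathbf{R}^\gamma,$$ $$\Lambda_{m,n}(\mathbf{R})=\sum_{j=0}^n(-1)^{n-j}\binom{n}{j}\Big(\sum_{i=1}^dR_i^*\Big)^j\,\mathbf{M}_m(\mathbf{R})\,\Big(\sum_{i=1}^dR_i\Big)^{n-j}.$$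 For positive integers $m,n$, a commuting tuple $\mathbf{R}$ is $(m,n)$-isosymmetric if $\Lambda_{m,n}(\mathbf{R})=0$. A commuting tuple $\mathbf{Q}$ is nilpotent of order $p$ ($p$-nilpotent), $p\ge1$, if $\mathbf{Q}^\alpha=Q_1^{\alpha_1}\cdots Q_d^{\alpha_d}=0$ for all $\alpha\in\mathbb{N}_0^d$ with $|\alpha|=p$. *)

(* Defs.v *)
From HB Require Import structures.
From mathcomp Require Import all_boot all_order all_algebra.
From mathcomp Require Import complex.
From mathcomp Require Import all_classical all_reals all_analysis.

Set Implicit Arguments.
Unset Strict Implicit.
Unset Printing Implicit Defensive.

Import Order.TTheory GRing.Theory Num.Theory.
Import numFieldNormedType.Exports.

Local Open Scope classical_set_scope.
Local Open Scope complex_scope.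
Local Open Scope ring_scope.

(* [inner] is linear in its first argument and conjugate-linear in the second;
   positive definiteness is part of [{dot H for _}]. *)
HB.mixin Record CompleteNormedModule_isHilbert (R : realType) H
    of CompleteNormedModule R[i] H := {
  inner : {dot H for (@Num.conj R[i])};
  inner_norm : forall x : H, inner x x = `|x| ^+ 2
}.

#[short(type="hilbertType")]
HB.structure Definition Hilbert (R : realType) :=
  {H of CompleteNormedModule R[i] H & CompleteNormedModule_isHilbert R H}.

Arguments inner {R s} : rename.

Definition separable (T : topologicalType) : Prop :=
  exists S : set T, countable S /\ dense S.

Section Operators.
Variables (R : realType) (H : hilbertType R).

Definition bounded_operator (T : H -> H) : Prop :=
  linear T /\ exists M : R[i], forall x, `|T x| <= M * `|x|.

(* For bounded [T], the vector [z] exists by the Riesz representation theorem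
   and is unique since [inner] is definite; the default 0 is not used then. *)
Definition adjoint (T : H -> H) : H -> H :=
  fun y => xget 0 [set z | forall x, inner (T x) y = inner x z].

Definition commutator (A B : H -> H) : H -> H := (A \o B) - (B \o A).

Definition commuting_tuple d (T : 'I_d -> H -> H) : Prop :=
  (forall i, bounded_operator (T i)) /\
  (forall i j, T i \o T j = T j \o T i).

(* T_1^(a_1) o ... o T_d^(a_d), in this order *)
Definition tuple_exp d (T : 'I_d -> H -> H) (a : 'I_d -> nat) : H -> H :=
  \big[comp/id]_(i < d) iter (a i) (T i).

Definition nilpotent_tuple d (p : nat) (T : 'I_d -> H -> H) : Prop :=
  commuting_tuple T /\
  forall a : 'I_d -> nat, (\sum_(i < d) a i)%N = p -> tuple_exp T a = 0.

(* The multi-indices of weight j are enumerated by [{ffun 'I_d -> 'I_j.+1}],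
   since each of their entries is at most j. *)
Definition isoM d (m : nat) (T : 'I_d -> H -> H) : H -> H :=
  \sum_(j < m.+1) ((-1) ^+ (m - j) * 'C(m, j)%:R : R[i]) *:
    \sum_(a : {ffun 'I_d -> 'I_j.+1} | (\sum_(i < d) a i)%N == j)
      (j`!%:R / \prod_(i < d) (a i)`!%:R : R[i]) *:
        (tuple_exp (fun i => adjoint (T i)) (fun i => a i : nat)
           \o tuple_exp T (fun i => a i : nat)).

Definition Lambda d (m n : nat) (T : 'I_d -> H -> H) : H -> H :=
  \sum_(j < n.+1) ((-1) ^+ (n - j) * 'C(n, j)%:R : R[i]) *:
    (iter j (\sum_(i < d) adjoint (T i)) \o isoM m T
       \o iter (n - j) (\sum_(i < d) T i)).

Definition isosymmetric d (m n : nat) (T : 'I_d -> H -> H) : Prop :=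
  commuting_tuple T /\ Lambda m n T = 0.

End Operators.

(* Main.v *)
(* Let L_i and R_i be left multiplication by T_i^* and right multiplication by
   T_i on operators. Left and right multiplications commute, so the multinomial
   and binomial theorems give
     Lambda_(m,n)(T) = (sum_i L_i - sum_i R_i)^n (sum_i L_i R_i - 1)^m I.
   Passing from R to R + Q adds to [sum_i L_i R_i - 1] the two operators
   [sum_i L(Q_i^* ) R(R_i)] and [sum_i L(R_i^* + Q_i^* ) R(Q_i)], and to
   [sum_i L_i - sum_i R_i] the two operators [sum_i L(Q_i^* )] and
   [- sum_i R(Q_i)]. All four are k-nilpotent and everything commutes, so every
   term in the expansion of Lambda_(m+2k-2,n+2k-1)(R+Q) contains at least m
   factors [sum_i L(R_i^* ) R(R_i) - 1] and n factors
   [sum_i L(R_i^* ) - sum_i R(R_i)]. *)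
From HB Require Import structures.
Require Import Defs.
From mathcomp Require Import all_boot all_order all_algebra.
From mathcomp Require Import complex.
From mathcomp Require Import all_classical all_reals all_analysis.
From mathcomp Require Import zify ring lra.
Import Order.TTheory GRing.Theory Num.Theory.
Import numFieldNormedType.Exports.

Set Implicit Arguments.
Unset Strict Implicit.
Unset Printing Implicit Defensive.

Local Open Scope classical_set_scope.
Local Open Scope complex_scope.
Local Open Scope ring_scope.

(** * The ring of additive endomorphisms *)

(** Used at two levels: with [V := H] the elements are operators, with [V] a ring of operators they
    are maps on operators. Additivity is enough structure because all coefficients that occur are
    integers. *)
Record addend (V : zmodType) := AddEnd {
  addend_fun :> V -> V;
  addend_additive : zmod_morphism addend_fun }.
Arguments AddEnd {V addend_fun}.
Arguments addend_fun {V}.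

Section AddEndRing.
Variable V : zmodType.
Implicit Types f g h : addend V.

HB.instance Definition _ := gen_eqMixin (addend V).
HB.instance Definition _ := gen_choiceMixin (addend V).
HB.instance Definition _ f :=
  GRing.isZmodMorphism.Build V V (addend_fun f) (addend_additive f).

Lemma addendP f g : (forall x, f x = g x) -> f = g.
Proof.
case: f g => [f fB] [g gB] /= /funext fg; rewrite fg in fB *.
by congr AddEnd; exact: Prop_irrelevance.
Qed.

Fact addend0_subproof : zmod_morphism (fun _ : V => 0 : V).
Proof. by move=> x y; rewrite subr0. Qed.
Fact addendN_subproof f : zmod_morphism (fun x => - f x).
Proof. by move=> x y; rewrite raddfB opprB opprK addrC. Qed.
Fact addendD_subproof f g : zmod_morphism (fun x => f x + g x).
Proof. by move=> x y; rewrite !raddfB opprD addrACA. Qed.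
Fact addend1_subproof : zmod_morphism (id : V -> V).
Proof. by []. Qed.
Fact addendM_subproof f g : zmod_morphism (fun x => f (g x)).
Proof. by move=> x y; rewrite !raddfB. Qed.

Fact addend_addA : associative (fun f g => AddEnd (addendD_subproof f g)).
Proof. by move=> f g h; apply: addendP => x; rewrite /= addrA. Qed.
Fact addend_addC : commutative (fun f g => AddEnd (addendD_subproof f g)).
Proof. by move=> f g; apply: addendP => x; rewrite /= addrC. Qed.
Fact addend_add0 :
  left_id (AddEnd addend0_subproof) (fun f g => AddEnd (addendD_subproof f g)).
Proof. by move=> f; apply: addendP => x; rewrite /= add0r. Qed.
Fact addend_addN : left_inverse (AddEnd addend0_subproof)
  (fun f => AddEnd (addendN_subproof f))
  (fun f g => AddEnd (addendD_subproof f g)).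
Proof. by move=> f; apply: addendP => x; rewrite /= addNr. Qed.

HB.instance Definition _ := GRing.isZmodule.Build (addend V)
  addend_addA addend_addC addend_add0 addend_addN.

Fact addend_mulA : associative (fun f g => AddEnd (addendM_subproof f g)).
Proof. by move=> f g h; apply: addendP. Qed.
Fact addend_mul1 :
  left_id (AddEnd addend1_subproof) (fun f g => AddEnd (addendM_subproof f g)).
Proof. by move=> f; apply: addendP. Qed.
Fact addend_mulr1 :
  right_id (AddEnd addend1_subproof) (fun f g => AddEnd (addendM_subproof f g)).
Proof. by move=> f; apply: addendP. Qed.
Fact addend_mulDl : left_distributive
  (fun f g => AddEnd (addendM_subproof f g)) +%R.
Proof. by move=> f g h; apply: addendP. Qed.
Fact addend_mulDr : right_distributive
  (fun f g => AddEnd (addendM_subproof f g)) +%R.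
Proof. by move=> f g h; apply: addendP => x; rewrite /= raddfD. Qed.

HB.instance Definition _ := GRing.Zmodule_isPzRing.Build (addend V)
  addend_mulA addend_mul1 addend_mulr1 addend_mulDl addend_mulDr.

Lemma addendDE f g x : (f + g) x = f x + g x. Proof. by []. Qed.
Lemma addendME f g x : (f * g) x = f (g x). Proof. by []. Qed.

Lemma addend_sumE I (r : seq I) (P : pred I) (F : I -> addend V) x :
  (\sum_(i <- r | P i) F i) x = \sum_(i <- r | P i) F i x.
Proof. exact: (big_morph (fun f => addend_fun f x)). Qed.

Lemma addendMnE f n x : (f *+ n) x = f x *+ n.
Proof. by elim: n => // n IH; rewrite !mulrS addendDE IH. Qed.

Lemma addendXE f n x : (f ^+ n) x = iter n f x.
Proof. by elim: n => //= n IH; rewrite exprS addendME IH. Qed.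

End AddEndRing.

(** * The multinomial theorem for commuting families *)

Section Multinomial.

Definition multinomial d (a : 'I_d -> nat) : nat :=
  ((\sum_(i < d) a i)`! %/ \prod_(i < d) (a i)`!)%N.

(** The division in [multinomial] is exact: if p divides s! and q divides t!, then p q divides s!
    t!, hence (s + t)!. *)
Lemma multinomial_fact d (a : 'I_d -> nat) :
  (multinomial a * \prod_(i < d) (a i)`! = (\sum_(i < d) a i)`!)%N.
Proof.
rewrite divnK //.
apply: (big_ind2 (fun p s : nat => p %| s`!)%N) => // p s q t ps qt.
by rewrite -(bin_fact (leq_addr t s)) addKn dvdn_mull // dvdn_mul.
Qed.

Lemma sum_decr d (a : 'I_d -> nat) i : (0 < a i)%N ->
  (\sum_(l < d) a l = (\sum_(l < d) (a l - (l == i))).+1)%N.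
Proof.
move=> ai; rewrite (bigD1 i) //= [in RHS](bigD1 i) //= eqxx.
rewrite [in RHS](eq_bigr a) => [|l /negPf->]; first lia.
by rewrite subn0.
Qed.

(** After multiplication by the product of the factorials this reads (j + 1) j! = sum_i a_i j!. The
    guard [0 < a i] matters: at a zero entry, truncated subtraction would leave [a] unchanged. *)
Lemma multinomial_pascal d (a : 'I_d -> nat) j :
  (\sum_(i < d) a i = j.+1)%N ->
  multinomial a =
  (\sum_(i < d | 0 < a i) multinomial (fun l => a l - (l == i)))%N.
Proof.
move=> aj.
have a_gt0 : (0 < \prod_(i < d) (a i)`!)%N.
  by apply: prodn_gt0 => i; exact: fact_gt0.
apply/eqP; rewrite -(eqn_pmul2r a_gt0) multinomial_fact aj factS -{1}aj.
rewrite !big_distrl /= [X in (X == _)%N](bigID (fun i => (0 < a i)%N)) /=.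
rewrite [X in (_ + X)%N]big1 ?addn0 => [|i]; last by rewrite -eqn0Ngt => /eqP->.
apply/eqP; apply: eq_bigr => i ai.
have := multinomial_fact (fun l => a l - (l == i))%N.
have -> : (\sum_(l < d) (a l - (l == i)) = j)%N.
  by apply/eqP; rewrite -eqSS -sum_decr // aj.
move=> <-; rewrite mulnCA; congr (_ * _)%N.
rewrite (bigD1 i) //= [in RHS](bigD1 i) //= eqxx mulnA.
congr (_ * _)%N; first by rewrite subn1; case: (a i) ai.
by apply: eq_bigr => l /negPf->; rewrite subn0.
Qed.

(* [N] only bounds the exponents, so that the index type is finite. *)
Lemma expr_sum_comm (A : pzSemiRingType) d (z : 'I_d -> A) N j :
  (forall i l, GRing.comm (z i) (z l)) -> (j < N)%N ->
  (\sum_(i < d) z i) ^+ j =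
  \sum_(a : {ffun 'I_d -> 'I_N} | (\sum_(i < d) a i)%N == j)
     (\prod_(i < d) z i ^+ a i) *+ multinomial (fun i => a i : nat).
Proof.
case: N => // N zC; elim: j => [|j IH] jN.
  rewrite expr0 (big_pred1 [ffun=> ord0]) => [|a].
    rewrite big1 => [|i _]; last by rewrite ffunE.
    rewrite /multinomial !big1 // => i _; by rewrite ffunE.
  apply/eqP/eqP=> [a0|->]; last by rewrite big1 // => i _; rewrite ffunE.
  apply/ffunP => i; apply: val_inj; rewrite ffunE /=.
  by apply/eqP; move/eqP: a0; rewrite sum_nat_eq0 => /forallP/(_ i).
rewrite exprS (IH (ltnW jN)) mulr_suml.
pose F i (a : {ffun 'I_d -> 'I_N.+1}) :=
   (\prod_(l < d) z l ^+ a l) *+ multinomial (fun l => a l - (l == i))%N.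
(* Both sides equal this double sum: the right one by [multinomial_pascal], the left one by raising
   the [i]-th exponent of each multi-index. *)
transitivity (\sum_(i < d) \sum_(a : {ffun 'I_d -> 'I_N.+1} |
    ((\sum_(l < d) a l)%N == j.+1) && (0 < a i)%N) F i a); last first.
  rewrite (exchange_big_dep (fun a : {ffun 'I_d -> 'I_N.+1} =>
    (\sum_(i < d) a i)%N == j.+1)) /=; last by move=> i a _ /andP[].
  apply: eq_bigr => a /eqP aj; rewrite (multinomial_pascal aj) -sumrMnr.
  by apply: eq_bigl => i; rewrite aj eqxx.
apply: eq_bigr => i _; rewrite mulr_sumr.
(* In [inc], [inord] is faithful at weight [j]: the entries are then at most [j.+1], which is at
   most [N]. *)
pose inc (a : {ffun 'I_d -> 'I_N.+1}) :=
  [ffun l => inord (a l + (l == i)) : 'I_N.+1].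
pose dec (a : {ffun 'I_d -> 'I_N.+1}) :=
  [ffun l => inord (a l - (l == i)) : 'I_N.+1].
have decE a l : dec a l = (a l - (l == i))%N :> nat.
  by rewrite ffunE inordK // (leq_ltn_trans (leq_subr _ _)).
rewrite [RHS](reindex_onto inc dec) /=; last first.
  move=> a /andP[_ ai]; apply/ffunP => l; apply: val_inj; rewrite ffunE /= decE.
  rewrite subnK ?inordK //.
  by case: eqP => // ->.
have incE (a : {ffun 'I_d -> 'I_N.+1}) l : (\sum_(l < d) a l)%N = j ->
    inc a l = (a l + (l == i))%N :> nat.
  move=> aj; rewrite ffunE inordK //.
  have : (a l <= j)%N by rewrite -aj (bigD1 l) //= leq_addr.
  by case: (l == i); lia.
apply: eq_big => [a|a /eqP aj].
  apply/eqP/andP => [aj|[/andP[/eqP inc_j inc_i] /eqP dia]].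
    have incK : dec (inc a) = a.
      by apply/ffunP => l; apply: val_inj; rewrite /= decE incE // addnK.
    rewrite incK eqxx incE // eqxx addn1 ltnS leq0n andbT; split=> //.
    rewrite (@sum_decr _ _ i) ?incE ?eqxx ?addn1 //.
    rewrite (eq_bigr (fun l => a l : nat)) ?aj // => l _.
    by rewrite incE // addnK.
  (* The weight of [a] is not known yet, so [incE] does not apply; [dia] recovers [a] from
     [inc a]. *)
  move: inc_j; rewrite (@sum_decr _ _ i) // => -[<-].
  by apply: eq_bigr => l _; rewrite -{1}dia decE.
rewrite /F mulrnAr; congr (_ *+ _); last first.
  rewrite /multinomial; congr (_ `! %/ _)%N; apply: eq_bigr => l _;
  by rewrite incE // addnK.
have -> : \prod_(l < d) z l ^+ inc a l =
          \prod_(l < d) (z l ^+ (l == i) * z l ^+ a l).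
  by apply: eq_bigr => l _; rewrite -exprD incE // addnC.
rewrite prodrM_comm => [|l l' _ _]; last first.
  by do 2?apply: commrX; apply: commr_sym; apply: commrX.
congr (_ * _).
rewrite (eq_bigr (fun l => if l == i then z l else 1)) => [|l _]; last first.
  by case: eqP.
by rewrite -big_mkcond big_pred1_eq.
Qed.

End Multinomial.

(** * Powers of sums of commuting nilpotent elements *)

Definition commuting (A : pzSemiRingType) d (z : 'I_d -> A) :=
  forall i j, GRing.comm (z i) (z j).

Definition nilpotent (A : pzSemiRingType) d (z : 'I_d -> A) k :=
  forall a : 'I_d -> nat, (\sum_(i < d) a i)%N = k ->
    \prod_(i < d) z i ^+ a i = 0.

Section Binomial.
Variable V : zmodType.
Implicit Types f g : addend V.

(** Each binomial term has at least p factors [f] or at least q factors [g]. Vanishing is asked at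
    the single point [w], since isosymmetry says that a map vanishes at 1, not that it is
    nilpotent. *)
Lemma expr_sum_eq0 f g p q w : GRing.comm f g ->
  (f ^+ p) w = 0 -> (g ^+ q) w = 0 -> ((f + g) ^+ (p + q).-1) w = 0.
Proof.
move=> fg fp gq; rewrite exprDn_comm // addend_sumE big1 // => i _.
rewrite addendMnE; have [qi|iq] := leqP q i.
  by rewrite -(subnK qi) exprD !addendME gq !raddf0 mul0rn.
rewrite (commrX _ (commr_sym (commrX _ (commr_sym fg)))) addendME.
have /subnK <- : (p <= (p + q).-1 - i)%N by lia.
by rewrite exprD addendME fp !raddf0 mul0rn.
Qed.

End Binomial.

Section NilpotentSums.
Variables (A : pzSemiRingType) (d : nat).
Implicit Types z g h : 'I_d -> A.

Lemma commr_sum (x : A) z : (forall i, GRing.comm x (z i)) ->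
  GRing.comm x (\sum_(i < d) z i).
Proof. by move=> xz; apply: (big_ind _ (commr0 x) (@commrD _ x)). Qed.

(** Turns multi-index nilpotency into nilpotency of one element: every term of the multinomial
    expansion has weight [k]. *)
Lemma nilpotent_sum z k : commuting z -> nilpotent z k ->
  (\sum_(i < d) z i) ^+ k = 0.
Proof.
move=> zC z0; rewrite (expr_sum_comm (N := k.+1)) // big1 // => a /eqP ak.
by rewrite z0 // mul0rn.
Qed.

Lemma nilpotent_sum_mul g h k :
  commuting g -> commuting h ->
  (forall i l, GRing.comm (g i) (h l)) ->
  nilpotent h k ->
  (\sum_(i < d) g i * h i) ^+ k = 0.
Proof.
move=> gg hh gh h0; apply: nilpotent_sum => [i l|a ak].
  by apply: commrM; apply: commr_sym; apply: commrM => //; apply: commr_sym.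
rewrite (eq_bigr (fun i => g i ^+ a i * h i ^+ a i)) => [|i _]; last first.
  exact: exprMn_comm.
rewrite prodrM_comm => [|i l _ _]; last first.
  by apply: commrX; apply: commr_sym; apply: commrX; apply: commr_sym.
by rewrite h0 // mulr0.
Qed.

End NilpotentSums.

(** * Hereditary calculus *)

Section Hereditary.
Variables (A : pzRingType).
Implicit Types w p q : A.

Fact lmul_subproof p : zmod_morphism ( *%R p).
Proof. by move=> w w'; rewrite mulrBr. Qed.
Definition lmul p : addend A := AddEnd (lmul_subproof p).

Fact rmul_subproof p : zmod_morphism ( *%R^~ p).
Proof. by move=> w w'; rewrite mulrBl. Qed.
Definition rmul p : addend A := AddEnd (rmul_subproof p).

Fact lmul_additive : zmod_morphism lmul.
Proof. by move=> p q; apply: addendP => w; rewrite /= mulrBl. Qed.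
HB.instance Definition _ :=
  GRing.isZmodMorphism.Build A (addend A) lmul lmul_additive.

Fact rmul_additive : zmod_morphism rmul.
Proof. by move=> p q; apply: addendP => w; rewrite /= mulrBr. Qed.
HB.instance Definition _ :=
  GRing.isZmodMorphism.Build A (addend A) rmul rmul_additive.

Lemma lmulM p q : lmul (p * q) = lmul p * lmul q.
Proof. by apply: addendP => w; rewrite /= mulrA. Qed.

Lemma rmulM p q : rmul (p * q) = rmul q * rmul p.
Proof. by apply: addendP => w; rewrite /= mulrA. Qed.

Lemma lmulX p n : lmul p ^+ n = lmul (p ^+ n).
Proof.
elim: n => [|n IH]; last by rewrite !exprS IH lmulM.
by apply: addendP => w; rewrite /= mul1r.
Qed.

Lemma rmulX p n : rmul p ^+ n = rmul (p ^+ n).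
Proof.
elim: n => [|n IH]; last by rewrite exprS IH -rmulM exprSr.
by apply: addendP => w; rewrite /= mulr1.
Qed.

Lemma comm_lmul p q : GRing.comm p q -> GRing.comm (lmul p) (lmul q).
Proof. by rewrite /GRing.comm -!lmulM => ->. Qed.

Lemma comm_rmul p q : GRing.comm p q -> GRing.comm (rmul p) (rmul q).
Proof. by rewrite /GRing.comm -!rmulM => ->. Qed.

Lemma comm_lmul_rmul p q : GRing.comm (lmul p) (rmul q).
Proof. by apply: addendP => w; rewrite /= mulrA. Qed.
#[local] Hint Resolve comm_lmul_rmul : core.

Variable d : nat.
Implicit Types x y u v : 'I_d -> A.

Lemma prod_lmul y (a : 'I_d -> nat) :
  \prod_(i < d) lmul (y i) ^+ a i = lmul (\prod_(i < d) y i ^+ a i).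
Proof.
have lmul1 : lmul 1 = 1 by apply: addendP => w; rewrite /= mul1r.
by rewrite (big_morph lmul lmulM lmul1); apply: eq_bigr => i _; rewrite lmulX.
Qed.

(** [rmul] reverses products, so commutation of [x] is what restores the order of the factors. *)
Lemma prod_rmul x (a : 'I_d -> nat) : (forall i l, GRing.comm (x i) (x l)) ->
  \prod_(i < d) rmul (x i) ^+ a i = rmul (\prod_(i < d) x i ^+ a i).
Proof.
move=> xx; elim: (index_enum _) => [|i r IH].
  by rewrite !big_nil; apply: addendP => w; rewrite /= mulr1.
rewrite !big_cons IH rmulX -rmulM; congr rmul.
apply: commr_sym; apply: commr_prod => l _.
by apply: commrX; apply: commr_sym; apply: commrX.
Qed.

(** The elementary operator w |-> sum_i y_i w x_i; [shift] is the generalized derivation w |->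
    (sum_i y_i) w - w (sum_i x_i). *)
Definition dilation y x : addend A := \sum_(i < d) lmul (y i) * rmul (x i).
Definition shift y x : addend A :=
  lmul (\sum_(i < d) y i) - rmul (\sum_(i < d) x i).

(* The expressions of [isoM] and [Lambda] in an arbitrary ring, with [y] in the
   role of the adjoints of [x] and no relation assumed between [y] and [x]. *)
Definition her_isoM m y x : A := \sum_(j < m.+1) (-1) ^+ (m - j) *
  (\sum_(a : {ffun 'I_d -> 'I_j.+1} | (\sum_(i < d) a i)%N == j)
    (\prod_(i < d) y i ^+ a i * \prod_(i < d) x i ^+ a i)
       *+ multinomial (fun i => a i : nat)) *+ 'C(m, j).

Definition her_Lambda m n y x : A := \sum_(j < n.+1) (-1) ^+ (n - j) *
  ((\sum_(i < d) y i) ^+ j * her_isoM m y x * (\sum_(i < d) x i) ^+ (n - j))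
    *+ 'C(n, j).

Lemma addend_signE n (f : addend A) w : ((-1) ^+ n * f) w = (-1) ^+ n * f w.
Proof. by rewrite -signr_odd -[in RHS]signr_odd !mulr_sign; case: odd. Qed.

Lemma her_isoME m y x : commuting y -> commuting x ->
  her_isoM m y x = ((dilation y x - 1) ^+ m) 1.
Proof.
move=> yy xx; rewrite addrC exprDn_comm; last exact/commr_sym/commrN1.
rewrite addend_sumE; apply: eq_bigr => j _.
rewrite addendMnE addend_signE; congr (_ * _ *+ _).
rewrite (expr_sum_comm (N := j.+1)) // => [|i l]; last first.
  by apply: commrM; apply: commr_sym; apply: commrM => //;
  do ?[exact: comm_lmul | exact: comm_rmul | exact: commr_sym].
rewrite addend_sumE; apply: eq_bigr => a _; rewrite addendMnE; congr (_ *+ _).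
rewrite (eq_bigr (fun i => lmul (y i) ^+ a i * rmul (x i) ^+ a i)) => [|i _];
  last exact: exprMn_comm.
rewrite prodrM_comm => [|i l _ _]; last first.
  by rewrite lmulX rmulX.
by rewrite prod_lmul prod_rmul //= mul1r.
Qed.

Lemma her_LambdaE m n y x : commuting y -> commuting x ->
  her_Lambda m n y x = (shift y x ^+ n * (dilation y x - 1) ^+ m) 1.
Proof.
move=> yy xx; rewrite addendME -her_isoME // /shift addrC exprDn_comm; last first.
  exact/commr_sym/commrN.
rewrite addend_sumE; apply: eq_bigr => j _.
by rewrite addendMnE addendME (exprNn (rmul _)) addend_signE lmulX rmulX.
Qed.

Lemma comm_dilation y x v u :
  (forall i j, GRing.comm (y i) (v j)) ->
  (forall i j, GRing.comm (x i) (u j)) ->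
  GRing.comm (dilation y x) (dilation v u).
Proof.
move=> yv xu; apply: commr_sum => i; apply: commr_sym; apply: commr_sum => j.
by apply: commrM; apply: commr_sym; apply: commrM => //;
  do ?[exact: comm_lmul | exact: comm_rmul | exact: commr_sym].
Qed.

Lemma comm_shift_dilation y x v u :
  (forall i j, GRing.comm (y i) (v j)) ->
  (forall i j, GRing.comm (x i) (u j)) ->
  GRing.comm (shift y x) (dilation v u).
Proof.
move=> yv xu; apply: commr_sum => j; apply: commr_sym.
apply: commrB; apply: commr_sym; apply: commrM => //.
- by apply: comm_lmul; apply: commr_sym; apply: commr_sum => i; exact: commr_sym.
- exact: commr_sym.
- by apply: comm_rmul; apply: commr_sym; apply: commr_sum => i; exact: commr_sym.
Qed.

(** The purely algebraic form of the theorem: [y] and [v] stand for the adjoints of [x] and [u], and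
    enter through their commutation and nilpotency alone. *)
Lemma her_Lambda_perturbation m n k y x v u :
  commuting y -> commuting x -> commuting v -> commuting u ->
  (forall i j, GRing.comm (y i) (v j)) ->
  (forall i j, GRing.comm (x i) (u j)) ->
  nilpotent v k ->
  nilpotent u k ->
  (0 < k)%N ->
  her_Lambda m n y x = 0 ->
  her_Lambda (m + 2 * k - 2) (n + 2 * k - 1)
    (fun i => y i + v i) (fun i => x i + u i) = 0.
Proof.
move=> yy xx vv uu yv xu v0 u0 k0; rewrite !her_LambdaE //; last 2 first.
- by move=> i j; apply: commrD; apply: commr_sym; apply: commrD => //;
  exact: commr_sym.
- by move=> i j; apply: commrD; apply: commr_sym; apply: commrD => //;
  exact: commr_sym.
set e := shift y x; set a := dilation y x - 1 => yx0.
set Y := fun i => y i + v i; set X := fun i => x i + u i.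
have yY i j : GRing.comm (y i) (Y j) by exact: commrD.
have vY i j : GRing.comm (v i) (Y j) by apply: commrD => //; exact: commr_sym.
have xX i j : GRing.comm (x i) (X j) by exact: commrD.
have uX i j : GRing.comm (u i) (X j) by apply: commrD => //; exact: commr_sym.
have ux i j : GRing.comm (u i) (x j) by exact: commr_sym.
have vy i j : GRing.comm (v i) (y j) by exact: commr_sym.
(* Keeping y u + v u together as Y u leaves two nilpotent perturbations instead of three; each costs
   k - 1 in the exponent. *)
have dilE : dilation Y X - 1 = a + dilation v x + dilation Y u.
  rewrite /a [_ - 1 + _]addrAC [RHS]addrAC -!big_split /=; congr (_ - 1).
  by apply: eq_bigr => i _; rewrite /X /Y !raddfD /= mulrDr !mulrDl.
have shiftE :
    shift Y X = e + (lmul (\sum_(i < d) v i) - rmul (\sum_(i < d) u i)).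
  by rewrite /shift !big_split !raddfD /= addrACA.
have u0' : nilpotent (fun i => rmul (u i)) k.
  by move=> b bk; rewrite prod_rmul // u0 // raddf0.
have v0' : nilpotent (fun i => lmul (v i)) k.
  by move=> b bk; rewrite prod_lmul // v0 // raddf0.
have Yu0 : dilation Y u ^+ k = 0.
  apply: nilpotent_sum_mul => // i j; [apply: comm_lmul|exact: comm_rmul].
  by apply: commrD; apply: commr_sym.
have vx0 : dilation v x ^+ k = 0.
  rewrite /dilation (eq_bigr (fun i => rmul (x i) * lmul (v i))) => [|i _];
    last exact: comm_lmul_rmul.
  apply: nilpotent_sum_mul => // i j.
  - exact: comm_rmul.
  - exact: comm_lmul.
  - exact/commr_sym.
have ea : GRing.comm e a.
  by apply: commrB (commr1 _); exact: comm_shift_dilation.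
have evx : GRing.comm e (dilation v x) by exact: comm_shift_dilation.
have eYu : GRing.comm e (dilation Y u) by exact: comm_shift_dilation.
have avx : GRing.comm a (dilation v x).
  apply: commr_sym; apply: commrB (commr1 _); exact: comm_dilation.
have aYu : GRing.comm a (dilation Y u).
  apply: commr_sym; apply: commrB (commr1 _).
  by apply: comm_dilation => // i j; exact: commr_sym.
have vxYu : GRing.comm (dilation v x) (dilation Y u) by exact: comm_dilation.
(* The base point is e^n 1 rather than 1: since [e] and [a] commute, a^m kills it by [yx0], and two
   uses of [expr_sum_eq0] absorb the perturbations. *)
have step1 : ((dilation Y X - 1) ^+ (m + 2 * k - 2)) ((e ^+ n) 1) = 0.
  have -> : (m + 2 * k - 2 = ((m + k).-1 + k).-1)%N by lia.
  rewrite dilE; apply: expr_sum_eq0 => //; last by rewrite Yu0.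
  - by apply: commr_sym; apply: commrD; exact: commr_sym.
  apply: expr_sum_eq0 => //; last by rewrite vx0.
  by rewrite -addendME -(commrX _ (commr_sym (commrX _ (commr_sym ea)))).
rewrite addendME.
(* The exponent n + 2k - 2 already gives zero; the remaining factor is applied to 0. *)
have -> : (n + 2 * k - 1 = ((n + k).-1 + k).-1.+1)%N by lia.
rewrite exprS addendME.
suff -> : (shift Y X ^+ ((n + k).-1 + k).-1)
  (((dilation Y X - 1) ^+ (m + 2 * k - 2)) 1) = 0 by rewrite raddf0.
have vC : GRing.comm (lmul (\sum_(i < d) v i)) (shift y x).
  apply: commrB; last exact: comm_lmul_rmul.
  by apply: comm_lmul; apply: commr_sum => i; apply: commr_sym; apply: commr_sum.
have uC : GRing.comm (rmul (\sum_(i < d) u i)) (shift y x).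
  apply: commrB; first exact/commr_sym/comm_lmul_rmul.
  by apply: comm_rmul; apply: commr_sum => i; apply: commr_sym; apply: commr_sum.
rewrite shiftE addrA; apply: expr_sum_eq0.
- apply: commrN; apply: commr_sym; apply: commrD => //.
  exact/commr_sym/comm_lmul_rmul.
- apply: expr_sum_eq0; first exact: commr_sym.
    rewrite -addendME.
    (* Swapping the two powers turns [step1] into the vanishing of e^n at the image of 1 under the
       power of [dilation Y X - 1]. *)
    have -> // : GRing.comm (e ^+ n) ((dilation Y X - 1) ^+ (m + 2 * k - 2)).
    apply: commrX; apply: commr_sym; apply: commrX; apply: commr_sym.
    by rewrite dilE; apply: commrD => //; exact: commrD.
  by rewrite lmulX nilpotent_sum //= mul0r.
- by rewrite (exprNn (rmul _)) addend_signE rmulX nilpotent_sum // raddf0 mulr0.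
Qed.

End Hereditary.

(** * Riesz representation and adjoints *)

Section Riesz.
Local Notation Re := (@complex.Re _).
Variables (K : realType) (H : hilbertType K).
Implicit Types (x y z h : H) (t : K).

(** Norm and inner product of [H] take values in [K[i]]; with their real parts [H] is a real inner
    product space, and order arguments run in [K]. *)
Definition rnorm x : K := Re `|x|.
Definition rip x y : K := Re (inner x y).

Lemma rnormE x : `|x| = (rnorm x)%:C.
Proof. by rewrite /rnorm RRe_real // normr_real. Qed.

Lemma rnorm_ge0 x : 0 <= rnorm x.
Proof. by rewrite -lecR -rnormE normr_ge0. Qed.

Lemma ler_rnormD x y : rnorm (x + y) <= rnorm x + rnorm y.
Proof. by rewrite -lecR rmorphD /= -!rnormE ler_normD. Qed.

Lemma rnormN x : rnorm (- x) = rnorm x.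
Proof. by rewrite /rnorm normrN. Qed.

Lemma innerC x y : inner y x = (inner x y)^*.
Proof. by rewrite hermC expr0 mul1r. Qed.

Lemma ReD (u v : K[i]) : Re (u + v) = Re u + Re v.
Proof. by case: u v => [? ?] []. Qed.

Lemma ReMr t (u : K[i]) : Re (t%:C * u) = t * Re u.
Proof. by case: u => a b /=; rewrite mul0r subr0. Qed.

Lemma ripC x y : rip x y = rip y x.
Proof. by apply: complexI; rewrite /rip innerC !complexRe Re_conj. Qed.

Lemma ripDl x y z : rip (x + y) z = rip x z + rip y z.
Proof. by rewrite /rip linearDl ReD. Qed.

Lemma ripZl t x z : rip (t%:C *: x) z = t * rip x z.
Proof. by rewrite /rip linearZl_LR /= ReMr. Qed.

Lemma ripDr x y z : rip z (x + y) = rip z x + rip z y.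
Proof. by rewrite !(ripC z) ripDl. Qed.

Lemma ripZr t x z : rip z (t%:C *: x) = t * rip z x.
Proof. by rewrite !(ripC z) ripZl. Qed.

Lemma ripN x z : rip z (- x) = - rip z x.
Proof.
by have := ripZr (-1) x z; rewrite rmorphN /= rmorph1 scaleN1r mulN1r.
Qed.

Lemma rip_norm x : rip x x = rnorm x ^+ 2.
Proof. by rewrite /rip inner_norm rnormE -rmorphXn. Qed.

(** Cauchy-Schwarz is read off the squared triangle inequality, which holds in [H] as a normed
    space. *)
Lemma rip_le x y : rip x y <= rnorm x * rnorm y.
Proof.
have := ler_rnormD x y.
rewrite -(@ler_pXn2r _ 2) ?nnegrE ?addr_ge0 ?rnorm_ge0 //.
by rewrite -rip_norm ripDl !ripDr (ripC y x) sqrrD !rip_norm; lra.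
Qed.

Lemma rip_abs_le x y : `|rip x y| <= rnorm x * rnorm y.
Proof.
by rewrite ler_norml rip_le andbT lerNl -ripN (le_trans (rip_le _ _)) // rnormN.
Qed.

(* The representing vector minimizes the energy [|x|^2 - 2 phi x]. *)
Lemma real_riesz (phi : H -> K) (M : K) :
  (forall x y, phi (x + y) = phi x + phi y) ->
  (forall t x, phi (t%:C *: x) = t * phi x) ->
  (forall x, `|phi x| <= M * rnorm x) ->
  exists z, forall h, rip h z = phi h.
Proof.
move=> phiD phiZ phi_le.
pose g x := rip x x - 2 * phi x.
(* Complete the square: |x|^2 - 2 M |x| = (|x| - M)^2 - M^2. *)
have g_ge x : - M ^+ 2 <= g x.
  have /ler_normlP[_ le1] := phi_le x.
  by rewrite /g rip_norm; have := sqr_ge0 (rnorm x - M); nra.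
have g_inf : has_inf (range g).
  split; first by exists (g 0); exists 0.
  by exists (- M ^+ 2) => _ [x _ <-].
pose d := inf (range g).
have d_le x : d <= g x by apply: (ge_inf g_inf.2); exists x.
pose S (s : K) := [set x | g x <= d + s ^+ 2].
have S0 (s : K) : 0 < s -> S s !=set0.
  move=> s0; have [|_ [x _ <-] xs] := @inf_adherent _ _ (s ^+ 2) _ g_inf.
    by rewrite exprn_gt0.
  by exists x; exact: ltW.
have g_line x h t : g (x + t%:C *: h) =
    g x + 2 * t * (rip h x - phi h) + t ^+ 2 * rnorm h ^+ 2.
  rewrite /g !ripDl !ripDr !ripZl !ripZr phiD phiZ -[in RHS]rip_norm (ripC x h).
  by ring.
(* Parallelogram argument: eliminating the slope between t = 1 and t = 1/2 gives g((x + y)/2) = (g x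
   + g y)/2 - |x - y|^2/4, and the left side is at least d. *)
have S_diam (s : K) x y : 0 < s -> S s x -> S s y -> rnorm (x - y) <= 2 * s.
  move=> s0 xs ys.
  rewrite -(@ler_pXn2r _ 2) ?nnegrE ?rnorm_ge0 ?mulr_ge0 //; last exact: ltW.
  have gy := g_line x (y - x) 1; have gm := g_line x (y - x) (2^-1).
  move: gy gm (d_le (x + (2^-1)%:C *: (y - x))) xs ys.
  rewrite rmorph1 scale1r addrC subrK -(rnormN (x - y)) opprB /S /=.
  by move=> -> ->; lra.
(* The sets of near-minimizers generate a filter, Cauchy by [S_diam]; completeness of [H] yields its
   limit z. *)
pose F := filter_from [set s : K | 0 < s] S.
have S_sub (s t : K) : 0 < s -> s <= t -> S s `<=` S t.
  move=> s0 st x /=; rewrite /S /= => /le_trans; apply.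
  by rewrite lerD2l ler_pXn2r // nnegrE ltW // (lt_le_trans s0).
have FF : ProperFilter F.
  apply: filter_from_proper => [|s /= s0]; last exact: S0.
  apply: filter_from_filter; first by exists 1 => /=.
  move=> s t /= s0 t0; exists (Num.min s t); first by rewrite /= lt_min s0.
  by move=> x xm; split; move: xm; apply: S_sub;
    rewrite ?lt_min ?s0 //= ge_min lexx ?orbT.
have : cvg F.
  apply: cauchy_cvg; apply: cauchy_exP => eps eps0.
  have epsE : eps = (Re eps)%:C by rewrite RRe_real // gtr0_real.
  have e0 : 0 < Re eps by rewrite -ltcR -epsE.
  have s0 : 0 < Re eps / 4 by rewrite divr_gt0.
  have [x xs] := S0 _ s0; exists x; exists (Re eps / 4) => // y ys.
  rewrite -ball_normE /= epsE rnormE ltcR.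
  by apply: le_lt_trans (S_diam _ _ _ s0 xs ys) _; lra.
move=> /cvg_ex[z Fz]; exists z => h.
have near_z (s : K) : 0 < s -> exists2 x, S s x & rnorm (z - x) < s.
  move=> s0; have /Fz [t /= t0 tz] : nbhs z (ball z s%:C).
    by apply: nbhsx_ballx; rewrite ltcR.
  have m0 : 0 < Num.min s t by rewrite lt_min s0.
  have [x xm] := S0 _ m0; exists x.
    by apply: S_sub xm => //; rewrite ge_min lexx.
  have /tz : S t x by apply: S_sub xm => //; rewrite ge_min lexx orbT.
  by rewrite -ball_normE /= rnormE ltcR.
apply/eqP; rewrite -subr_eq0 -normr_eq0.
apply/eqP/le_anti; rewrite normr_ge0 andbT.
(* [B] collects the bounds [le3] and [le4], so that with s = e / B the total error is at most e. *)
pose B := 1 + rnorm h ^+ 2 + rnorm h.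
have B0 : 0 < B by rewrite /B; have := rnorm_ge0 h; nra.
apply/ler_addgt0Pr => e e0; rewrite add0r.
have s0 : 0 < e / B by rewrite divr_gt0.
set s := e / B in s0 *.
have eE : e = s * B by rewrite /s divfK // gt_eqF.
have [x xs xz] := near_z _ s0.
have le1 := d_le (x + s%:C *: h).
have le2 := d_le (x + (- s)%:C *: h).
have le3 : `|rip h z - rip h x| <= rnorm h * s.
  rewrite -ripN -ripDr (le_trans (rip_abs_le _ _)) //.
  by rewrite ler_wpM2l ?rnorm_ge0 ?ltW.
(* The value of g at x is within s^2 of the infimum, so neither step s h nor step - s h can lower it
   by more; this bounds the slope in direction h from both sides. *)
have le4 : `|rip h x - phi h| <= s * (1 + rnorm h ^+ 2).
  move: le1 le2; rewrite !g_line; move: xs; rewrite /S /= => xs le1 le2.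
  have n0 := sqr_ge0 (rnorm h).
  by rewrite ler_norml; apply/andP; split; rewrite -(ler_pM2l s0); nra.
have -> : rip h z - phi h = (rip h z - rip h x) + (rip h x - phi h) by ring.
rewrite (le_trans (ler_normD _ _)) // eE /B.
by move: le3 le4; nra.
Qed.

Lemma inner_inj y z : (forall x, inner x y = inner x z) -> y = z.
Proof.
move=> yz; apply/eqP; rewrite -subr_eq0 -normr_eq0 -sqrf_eq0 -inner_norm.
by rewrite linearBr /= yz subrr.
Qed.

(** A relational form of adjointness: [is_adjoint_inj] makes [T] unique, so identities between
    adjoints are proved without unfolding [xget]. *)
Definition is_adjoint (S T : H -> H) :=
  forall x y, inner (S x) y = inner x (T y).

Lemma is_adjoint_inj (S T T' : H -> H) :
  is_adjoint S T -> is_adjoint S T' -> T = T'.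
Proof.
by move=> ST ST'; apply/funext => y; apply: inner_inj => x; rewrite -ST ST'.
Qed.

Lemma is_adjoint_additive (S T : H -> H) : is_adjoint S T -> zmod_morphism T.
Proof.
by move=> ST y y'; apply: inner_inj => x; rewrite linearBr /= -!ST linearBr.
Qed.

(** Riesz representation rules out the default value of [xget]. [real_riesz] gives a z matching the
    real parts; testing it at i x gives the imaginary ones. *)
Lemma adjointP (T : H -> H) : bounded_operator T -> is_adjoint T (adjoint T).
Proof.
move=> [Tlin [M TM]] x y; move: x.
suff [z zP] : exists z, forall x, inner (T x) y = inner x z.
  pose P z := forall x, inner (T x) y = inner x z.
  exact: (xgetPex 0 (ex_intro P z zP)).
have TD u v : T (u + v) = T u + T v by have := Tlin 1 u v; rewrite !scale1r.
have T0 : T 0 = 0 by apply: (addrI (T 0)); rewrite -TD !addr0.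
have TZ c u : T (c *: u) = c *: T u by have := Tlin c u 0; rewrite T0 !addr0.
(* [M] is a complex number in [bounded_operator]; comparing real parts yields a real bound. *)
have TMr u : rnorm (T u) <= Re M * rnorm u.
  have := TM u; rewrite !rnormE lecE => /andP[_].
  by rewrite /= mulrC ReMr mulrC.
have [||h|z zP] := @real_riesz (fun x => rip (T x) y) (Re M * rnorm y).
- by move=> u v; rewrite TD ripDl.
- by move=> t u; rewrite TZ ripZl.
- rewrite (le_trans (rip_abs_le _ _)) // mulrAC.
  by rewrite ler_wpM2r ?rnorm_ge0.
exists z => x; apply/eqP; rewrite eq_complex; apply/andP; split.
  by rewrite -[X in X == _]/(rip _ _) -zP.
have := zP ('i%C *: x); rewrite TZ /rip !linearZl_LR /=.
by rewrite ![_ * inner _ _]mulrC !ReiNIm => /oppr_inj ->.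
Qed.

End Riesz.

(** * Bounded operators as ring elements *)

Section OperatorRing.
Variables (K : realType) (H : hilbertType K).

Lemma linear_zmod_morphism (T : H -> H) : linear T -> zmod_morphism T.
Proof.
by move=> Tlin x y; rewrite addrC -scaleN1r Tlin scaleN1r addrC.
Qed.

Lemma is_adjointM (p q p' q' : addend H) : is_adjoint p q -> is_adjoint p' q' ->
  is_adjoint (p * p') (q' * q).
Proof. by move=> pq pq' x y; rewrite !addendME pq pq'. Qed.

Lemma is_adjointX (p q : addend H) n :
  is_adjoint p q -> is_adjoint (p ^+ n) (q ^+ n).
Proof.
move=> pq; elim: n => [|n IH] //; rewrite exprS exprSr; exact: is_adjointM.
Qed.

(** q' q is adjoint to p p' and q q' to p' p; as p p' = p' p, uniqueness of adjoints applies. *)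
Lemma is_adjoint_comm (p q p' q' : addend H) :
  is_adjoint p q -> is_adjoint p' q' ->
  GRing.comm p p' -> GRing.comm q q'.
Proof.
move=> pq pq' pp'; apply: addendP => y.
have := is_adjointM pq pq'; rewrite pp'.
move/(is_adjoint_inj (is_adjointM pq' pq)).
by move/(congr1 (fun f => f y)).
Qed.

Lemma is_adjoint_prod d (p q : 'I_d -> addend H) (a : 'I_d -> nat) :
  (forall i, is_adjoint (p i) (q i)) -> commuting q ->
  is_adjoint (\prod_(i < d) p i ^+ a i) (\prod_(i < d) q i ^+ a i).
Proof.
move=> pq qq; elim: (index_enum _) => [|i r IH]; first by rewrite !big_nil.
rewrite !big_cons [q i ^+ _ * _]commr_prod => [|l _].
  by apply: is_adjointM IH; exact: is_adjointX.
by apply: commrX; apply: commr_sym; apply: commrX.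
Qed.

Lemma tuple_expE d (T : 'I_d -> H -> H) (p : 'I_d -> addend H)
    (a : 'I_d -> nat) :
  (forall i, T i = p i) -> tuple_exp T a = \prod_(i < d) p i ^+ a i.
Proof.
move=> Tp; rewrite /tuple_exp.
rewrite (big_morph (@addend_fun H) (id1 := id) (op1 := comp)) //.
by apply: eq_bigr => i _; rewrite Tp; apply/funext => x; rewrite addendXE.
Qed.

Lemma sum_addendE (I : Type) (r : seq I) (P : pred I) (F : I -> addend H) :
  \sum_(i <- r | P i) (F i : H -> H) = \sum_(i <- r | P i) F i.
Proof. by apply/funext => x; rewrite fct_sumE addend_sumE. Qed.

(** The complex coefficients of [isoM] and [Lambda] are integers in value, so they can be moved into
    the ring [addend H]; [scale_multinomialE] does the same for the factorial quotients. *)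
Lemma scale_signE n c (p : addend H) :
  ((-1) ^+ n * c%:R : K[i]) *: (p : H -> H) = ((-1) ^+ n * p *+ c : addend H).
Proof.
apply/funext => x; rewrite addendMnE /GRing.scale /= mulrC -scalerA scaler_nat.
by rewrite -signr_odd -[in RHS]signr_odd scaler_sign; case: odd.
Qed.

Lemma scale_multinomialE d (a : 'I_d -> nat) j (p : addend H) :
  (\sum_(i < d) a i)%N = j ->
  (j`!%:R / \prod_(i < d) (a i)`!%:R : K[i]) *: (p : H -> H) =
  (p *+ multinomial a : addend H).
Proof.
move=> <-; apply/funext => x.
rewrite addendMnE -multinomial_fact natrM natr_prod.
rewrite mulfK; first exact: scaler_nat.
by apply/prodf_neq0 => i _; rewrite pnatr_eq0 -lt0n fact_gt0.
Qed.

Lemma isoME d m (T : 'I_d -> H -> H) (p q : 'I_d -> addend H) :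
  (forall i, T i = p i) -> (forall i, adjoint (T i) = q i) ->
  isoM m T = her_isoM m q p.
Proof.
move=> Tp Tq; rewrite /isoM /her_isoM -sum_addendE; apply: eq_bigr => j _.
rewrite -scale_signE -sum_addendE; congr (_ *: _); apply: eq_bigr => a /eqP aj.
by rewrite -(scale_multinomialE _ aj) (tuple_expE _ Tp) (tuple_expE _ Tq).
Qed.

Lemma LambdaE d m n (T : 'I_d -> H -> H) (p q : 'I_d -> addend H) :
  (forall i, T i = p i) -> (forall i, adjoint (T i) = q i) ->
  Lambda m n T = her_Lambda m n q p.
Proof.
move=> Tp Tq; rewrite /Lambda /her_Lambda -sum_addendE; apply: eq_bigr => j _.
rewrite -scale_signE; congr (_ *: _); rewrite (isoME _ Tp Tq).
rewrite (eq_bigr _ (fun i _ => Tp i)) (eq_bigr _ (fun i _ => Tq i)).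
by rewrite !sum_addendE; apply/funext => x; rewrite !addendME !addendXE.
Qed.

Lemma bounded_operatorD (S T : H -> H) :
  bounded_operator S -> bounded_operator T -> bounded_operator (S + T).
Proof.
move=> [Sl [M SM]] [Tl [N TN]]; split.
  by move=> c x y; rewrite /= /GRing.add /= Sl Tl scalerDr addrACA.
exists (M + N) => x; rewrite mulrDl.
by rewrite (le_trans (ler_normD _ _)) // lerD.
Qed.

Lemma commutator_eq0 (p q : addend H) :
  commutator p q = 0 -> GRing.comm p q.
Proof.
move=> pq; apply: addendP => x; apply/eqP; rewrite -subr_eq0; apply/eqP.
exact: (congr1 (fun f => f x) pq).
Qed.

End OperatorRing.

(** * Nilpotent perturbations of isosymmetric tuples *)

Theorem theorem2p11 (K : realType) (H : hilbertType K) (sepH : separable H)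
    (d m n k : nat) (d_gt0 : (0 < d)%N) (m_gt0 : (0 < m)%N) (n_gt0 : (0 < n)%N)
    (k_gt0 : (0 < k)%N) (R Q : 'I_d -> H -> H)
    (R_comm : commuting_tuple R) (Q_comm : commuting_tuple Q)
    (RQ : forall i j, commutator (R j) (Q i) = 0)
    (RQadj : forall i j, commutator (R j) (adjoint (Q i)) = 0)
    (R_iso : isosymmetric m n R) (Q_nilp : nilpotent_tuple k Q) :
  isosymmetric (m + 2 * k - 2)%N (n + 2 * k - 1)%N (fun i => R i + Q i).
Proof.
case: R_comm Q_comm R_iso Q_nilp => [Rb RR] [Qb QQ] [_ R0] [_ Q0].
have RQb i : bounded_operator (R i + Q i) by exact: bounded_operatorD.
have op_additive (T : H -> H) : bounded_operator T -> zmod_morphism T.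
  by case=> Tl _; exact: linear_zmod_morphism.
have adj_additive (T : H -> H) :
    bounded_operator T -> zmod_morphism (adjoint T).
  by move=> /adjointP; exact: is_adjoint_additive.
pose x i := AddEnd (op_additive _ (Rb i)).
pose y i := AddEnd (adj_additive _ (Rb i)).
pose u i := AddEnd (op_additive _ (Qb i)).
pose v i := AddEnd (adj_additive _ (Qb i)).
have xy i : is_adjoint (x i) (y i) := adjointP (Rb i).
have uv i : is_adjoint (u i) (v i) := adjointP (Qb i).
have xx : commuting x.
  by move=> i j; apply: addendP => w; exact: (congr1 (fun f => f w) (RR i j)).
have uu : commuting u.
  by move=> i j; apply: addendP => w; exact: (congr1 (fun f => f w) (QQ i j)).
have xu i j : GRing.comm (x i) (u j) :=
  commutator_eq0 (p := x i) (q := u j) (RQ j i).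
have yy : commuting y.
  by move=> i j; exact: is_adjoint_comm (xy i) (xy j) (xx i j).
have vv : commuting v.
  by move=> i j; exact: is_adjoint_comm (uv i) (uv j) (uu i j).
have yv i j : GRing.comm (y i) (v j).
  exact: is_adjoint_comm (xy i) (uv j) (xu i j).
have u0 : nilpotent u k.
  move=> a /Q0; rewrite (@tuple_expE _ _ _ Q u) // => ua; apply: addendP => w.
  by rewrite ua.
(* For all z, <z, v^a w> = <u^a z, w> = 0, so v^a w = 0. *)
have v0 : nilpotent v k.
  move=> a /u0 ua; apply: addendP => w; apply: inner_inj => z.
  by rewrite -(is_adjoint_prod a uv vv) ua /= linear0l linear0r.
split; first split => // i j.
  have xuC : GRing.comm (x i + u i) (x j + u j).
    by apply: commrD; apply: commr_sym; apply: commrD => //; exact: commr_sym.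
  exact: (congr1 (@addend_fun H) xuC).
rewrite (@LambdaE _ _ _ _ _ _ (fun i => x i + u i) (fun i => y i + v i)) //.
  rewrite her_Lambda_perturbation //.
  by apply: addendP => w; rewrite -(@LambdaE _ _ _ _ _ R x y) // R0.
(* By uniqueness, the chosen adjoint of R_i + Q_i is y_i + v_i. *)
move=> i; apply: is_adjoint_inj (adjointP (RQb i)) _ => w z.
by rewrite linearDl linearDr /=; congr (_ + _); [exact: xy|exact: uv].
Qed.
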